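(* Let $p$ be a prime, $\alpha\geq 1$ an integer, and $\Gamma=\mathrm{Cay}(\mathbb{Z}_{p}\times\mathbb{Z}_{p^{\alpha}},\Phi)$ with $\Phi=\varphi_p\times\varphi_{p^\alpha}$. Then (1) $\mathrm{diam}(\Gamma)=1$ if $p=2$ and $\alpha=1$; (2) $\mathrm{diam}(\Gamma)=2$ if either $p=2$ and $\alpha\geq 2$, or $p\geq 3$ and $\alpha\geq 1$.
   Context: For $n\geq 1$, $\mathbb{Z}_n=\{0,\dots,n-1\}$ is the integers mod $n$ and $\varphi_n$ is the set of elements of $\mathbb{Z}_n$ coprime to $n$ ($\varphi_p=\mathbb{Z}_p\setminus\{0\}$ for $p$ prime). $\mathrm{Cay}(\mathbb{Z}_p\times\mathbb{Z}_m,\varphi_p\times\varphi_m)$ is the graph on $\mathbb{Z}_p\times\mathbb{Z}_m$ where $(u,v)\sim(u',v')$ iff $u-u'\in\varphi_p$ and $v-v'\in\varphi_m$. The diameter of a disconnected graph is, by convention, the maximum of the diameters of its connected components. *)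

(* Defs.v *)
From HB Require Import structures.
From mathcomp Require Import all_boot all_algebra.
Set Implicit Arguments.
Unset Strict Implicit.
Unset Printing Implicit Defensive.

Import GRing.Theory.

Definition has_walk (T : finType) (e : rel T) (x y : T) (n : nat) : bool :=
  [exists w : n.-tuple T, path e x w && (last x w == y)].

(* A shortest walk has length < #|T|, so the search below succeeds exactly when
   x and y are connected; otherwise the value is the junk value #|T|. *)
Definition dist (T : finType) (e : rel T) (x y : T) : nat :=
  find (has_walk e x y) (iota 0 #|T|).

Lemma dist_walk (T : finType) (e : rel T) (x y : T) :
  connect e x y -> has_walk e x y (dist e x y).
Proof.
move=> /connectP[q0 eq0 ->] {y}; case/shortenP: eq0 => q eq uq _.
have hw : has (has_walk e x (last x q)) (iota 0 #|T|).
  apply/hasP; exists (size q).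
    by rewrite mem_iota /= add0n -[(size q).+1]/(size (x :: q)) -(card_uniqP uq) max_card.
  by apply/existsP; exists (in_tuple q); rewrite eq eqxx.
have := nth_find 0 hw; rewrite nth_iota ?add0n //.
by move: hw; rewrite has_find size_iota.
Qed.

Lemma dist_min (T : finType) (e : rel T) (x y : T) (n : nat) :
  has_walk e x y n -> dist e x y <= n.
Proof.
move=> hn; rewrite leqNgt; apply/negP => ltn.
have := before_find 0 ltn; rewrite nth_iota ?add0n ?hn //.
by apply: leq_trans ltn _; rewrite -[X in _ <= X](size_iota 0) find_size.
Qed.

Definition component (T : finType) (e : rel T) (x : T) : {set T} :=
  [set y | connect e x y].

Definition components (T : finType) (e : rel T) : {set {set T}} :=
  [set component e x | x : T].

(* For a component C, distances in the subgraph induced on C agree with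
   distances in the whole graph, since walks never leave C. *)
Definition component_diam (T : finType) (e : rel T) (C : {set T}) : nat :=
  \max_(x in C) \max_(y in C) dist e x y.

Definition diam (T : finType) (e : rel T) : nat :=
  \max_(C in components e) component_diam e C.

Definition Cay (G : zmodType) (S : {pred G}) : rel G :=
  fun x y => (x - y)%R \in S.

(* 'Z_n is the ring of integers mod n only for n >= 2. *)
Definition varphi (n : nat) : {set 'Z_n} := [set x : 'Z_n | coprime x n].

Definition Gamma (p alpha : nat) : rel ('Z_p * 'Z_(p ^ alpha))%type :=
  @Cay ('Z_p * 'Z_(p ^ alpha))%type (setX (varphi p) (varphi (p ^ alpha))).
Arguments Gamma : clear implicits.

(* Main.v *)
(** Subtracting in ['Z_(p ^ alpha)] and testing coprimality only depends on
    residues mod [p]: [x] and [y] are adjacent iff they differ mod [p] in both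
    coordinates.  If [p >= 3], any two vertices have a common neighbour, since
    each coordinate of it has to avoid at most two of the [p] residues.
    If [p = 2], every edge flips both parities, so inside a component two
    vertices agree in both parities, and have a common neighbour, or in none,
    and are adjacent. *)
Require Import Defs.
From HB Require Import structures.
From mathcomp Require Import all_boot all_algebra.

Set Implicit Arguments.
Unset Strict Implicit.
Unset Printing Implicit Defensive.

Section Diameter.
Variables (T : finType) (e : rel T).

Lemma has_walk0 x y : has_walk e x y 0 = (x == y).
Proof.
apply/existsP/idP => [[w]|xy]; first by rewrite tuple0.
by exists [tuple].
Qed.

Lemma has_walk1 x y : has_walk e x y 1 = e x y.
Proof.
apply/existsP/idP => [[w]|exy].
  by case/tupleP: w => z w; rewrite tuple0 /= andbT => /andP[ez /eqP <-].
by exists [tuple y]; rewrite /= exy eqxx.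
Qed.

Lemma has_walk2 x z y : e x z -> e z y -> has_walk e x y 2.
Proof. by move=> xz zy; apply/existsP; exists [tuple z; y]; rewrite /= xz zy /=. Qed.

Lemma dist_gt0 x y : connect e x y -> x != y -> 0 < dist e x y.
Proof.
move=> /dist_walk; case: (dist e x y) => // /[!has_walk0] /eqP ->.
by rewrite eqxx.
Qed.

Lemma dist_gt1 x y : connect e x y -> x != y -> ~~ e x y -> 1 < dist e x y.
Proof.
move=> /dist_walk; case: (dist e x y) => [|[|//]].
  by rewrite has_walk0 => /eqP ->; rewrite eqxx.
by rewrite has_walk1 => ->.
Qed.

(** Two vertices of one component are only known to be reachable from its base point [x0]; symmetry
    turns this into a connection between them. *)
Lemma diam_leq d : connect_sym e ->
  (forall x y, connect e x y -> dist e x y <= d) -> diam e <= d.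
Proof.
move=> eC le_d; apply/bigmax_leqP => _ /imsetP[x0 _ ->].
apply/bigmax_leqP => x /[!inE] x0x; apply/bigmax_leqP => y /[!inE] x0y.
by apply: le_d; apply: connect_trans x0y; rewrite eC.
Qed.

Lemma dist_leq_diam x y : connect e x y -> dist e x y <= diam e.
Proof.
move=> xy; have Cx : x \in component e x by rewrite inE connect0.
have Cy : y \in component e x by rewrite inE.
have CC : component e x \in components e by apply: imset_f.
apply: leq_trans (leq_bigmax_cond _ CC).
by apply: leq_trans (leq_bigmax_cond _ Cx); apply: leq_trans (leq_bigmax_cond _ Cy).
Qed.

End Diameter.

Section Residues.
Variables (p alpha : nat).
Hypotheses (p_prime : prime p) (alpha_gt0 : 0 < alpha).

Lemma leq_prime_exp : p <= p ^ alpha.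
Proof. by rewrite -[X in X <= _]expn1 leq_pexp2l // prime_gt0. Qed.

Lemma prime_exp_gt1 : 1 < p ^ alpha.
Proof. exact: leq_trans (prime_gt1 p_prime) leq_prime_exp. Qed.

Lemma sub_in_varphi (x y : 'Z_(p ^ alpha)) :
  ((x - y)%R \in varphi (p ^ alpha)) = (x != y %[mod p]).
Proof.
rewrite inE coprime_pexpr // coprime_sym prime_coprime //; congr (~~ _).
have p_dvd : p %| (Zp_trunc (p ^ alpha)).+2.
  by rewrite (Zp_cast prime_exp_gt1) dvdn_exp.
(* With [x] written as [d + y], only an addition modulo [p ^ alpha] has to be unfolded. Reducing it
   further mod [p] is harmless as [p] divides [p ^ alpha], and [y] then cancels. *)
have -> : (x = (x - y + y)%R %[mod p]) by rewrite GRing.subrK.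
move: (x - y)%R => d; rewrite /= modn_dvdm //.
by rewrite -[X in _ == X %[mod p]]add0n eqn_modDr mod0n.
Qed.

Lemma residue_avoiding (x y : 'Z_(p ^ alpha)) :
  2 < p \/ x = y %[mod p] ->
  exists z : 'Z_(p ^ alpha), (x != z %[mod p]) && (z != y %[mod p]).
Proof.
have witness k : k < p -> x %% p != k -> y %% p != k ->
    exists z : 'Z_(p ^ alpha), (x != z %[mod p]) && (z != y %[mod p]).
  move=> kp xk yk; exists (k%:R)%R.
  rewrite val_Zp_nat ?prime_exp_gt1 // (modn_small (leq_trans kp leq_prime_exp)).
  by rewrite (modn_small kp) xk eq_sym.
have p_gt1 := prime_gt1 p_prime; case=> [p_gt2|xy].
  (* Two residues cannot occupy all of 0, 1 and 2. *)
  have := witness 0 (ltnW p_gt1); have := witness 1 p_gt1; have := witness 2 p_gt2.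
  by case: (x %% p) (y %% p) => [|[|[|a]]] [|[|[|b]]] w2 w1 w0;
    solve [exact: w0 | exact: w1 | exact: w2].
(* Only one residue is to be avoided, so 0 or 1 is free. *)
have := witness 0 (ltnW p_gt1); have := witness 1 p_gt1; rewrite -xy.
by case: (x %% p) => [|a] w1 w0; [exact: w1 | exact: w0].
Qed.

End Residues.

Section GammaDiameter.
Variables (p alpha : nat).
Hypotheses (p_prime : prime p) (alpha_gt0 : 0 < alpha).
Implicit Types x y : ('Z_p * 'Z_(p ^ alpha))%type.

Lemma GammaE x y :
  Gamma p alpha x y = (x.1 != y.1 %[mod p]) && (x.2 != y.2 %[mod p]).
Proof.
rewrite /Gamma /Cay inE /= (sub_in_varphi p_prime alpha_gt0); congr (_ && _).
(* [p ^ 1] reduces to [p], so the factor ['Z_p] is the case of exponent 1. *)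
exact: (@sub_in_varphi p 1).
Qed.

Lemma Gamma_connect_sym : connect_sym (Gamma p alpha).
Proof.
apply: sym_connect_sym => x y.
by rewrite !GammaE eq_sym [x.2 %% _ == _]eq_sym.
Qed.

Lemma Gamma_walk2 x y :
  2 < p \/ (x.1 = y.1 %[mod p] /\ x.2 = y.2 %[mod p]) ->
  has_walk (Gamma p alpha) x y 2.
Proof.
move=> h.
have [|z1 /andP[xz1 zy1]] := @residue_avoiding p 1 p_prime isT x.1 y.1.
  by case: h => [|[]]; [left | right].
have [|z2 /andP[xz2 zy2]] := residue_avoiding p_prime alpha_gt0 (x := x.2) (y := y.2).
  by case: h => [|[]]; [left | right].
by apply: (@has_walk2 _ _ _ (z1, z2)); rewrite GammaE ?xz1 ?zy1.
Qed.

Lemma Gamma_connect2 x y : p = 2 -> connect (Gamma p alpha) x y ->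
  (x.1 == y.1 %[mod p]) = (x.2 == y.2 %[mod p]).
Proof.
(* The invariant of a component is the parity of the sum of the coordinates: an edge flips both
   summands. *)
move=> p2 xy; pose a := [pred z : 'Z_p * 'Z_(p ^ alpha) | odd z.1 (+) odd z.2].
have eq_mod2 (m n : nat) : (m == n %[mod p]) = (odd m == odd n).
  by rewrite p2 !modn2; case: (odd m); case: (odd n).
have a_closed : closed (Gamma p alpha) a.
  move=> u v; rewrite GammaE !eq_mod2 !inE.
  by case: (odd u.1) (odd u.2) (odd v.1) (odd v.2) => [] [] [] [].
have := closed_connect a_closed xy; rewrite !eq_mod2 !inE.
by case: (odd x.1) (odd x.2) (odd y.1) (odd y.2) => [] [] [] [].
Qed.

Lemma Gamma_dist_leq2 x y : connect (Gamma p alpha) x y ->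
  dist (Gamma p alpha) x y <= 2.
Proof.
move=> xy; have [p_gt2|p_le2] := ltnP 2 p.
  by apply/dist_min/Gamma_walk2; left.
have /(Gamma_connect2)/(_ xy) : p = 2 by apply/eqP; rewrite eqn_leq p_le2 prime_gt1.
have [xy1 /esym/eqP xy2|xy1 /esym/negbT xy2] := eqVneq (x.1 %% p) (y.1 %% p).
  by apply/dist_min/Gamma_walk2; right.
by apply/leqW/dist_min; rewrite has_walk1 GammaE xy1 xy2.
Qed.

End GammaDiameter.

Lemma diam_Gamma21 : diam (Gamma 2 1) = 1.
Proof.
have Gamma_sym := @Gamma_connect_sym 2 1 isT isT.
apply/eqP; rewrite eqn_leq; apply/andP; split.
  apply: diam_leq => // x y xy.
  have := @Gamma_connect2 2 1 isT isT x y erefl xy.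
  have [xy1 /esym/eqP xy2|xy1 /esym/negbT xy2] := eqVneq (x.1 %% 2) (y.1 %% 2).
    (* For [alpha = 1] a coordinate is its own residue mod 2, so vertices agreeing in both parities
       are equal. *)
    apply/leqW/dist_min; rewrite has_walk0 -pair_eqE /pair_eq -!val_eqE /=.
    by move: xy1 xy2; rewrite !modn_small ?ltn_ord // => -> ->; rewrite !eqxx.
  by apply/dist_min; rewrite has_walk1 GammaE // xy1 xy2.
have e01 : connect (Gamma 2 1) (0, 0)%R (1, 1)%R by apply: connect1; rewrite GammaE.
by apply: leq_trans (dist_leq_diam e01); apply: dist_gt0.
Qed.

Theorem theorem2p1 (p alpha : nat) (p_prime : prime p) (alpha_ge1 : 1 <= alpha) :
  (p = 2 /\ alpha = 1 -> diam (Gamma p alpha) = 1) /\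
  ((p = 2 /\ 2 <= alpha) \/ (3 <= p /\ 1 <= alpha) -> diam (Gamma p alpha) = 2).
Proof.
split=> [[-> ->]|cases]; first exact: diam_Gamma21.
apply/eqP; rewrite eqn_leq; apply/andP; split.
  apply: diam_leq; first exact: Gamma_connect_sym.
  by move=> x y; apply: Gamma_dist_leq2.
(* The vertices [(0, 0)] and [(0, k)] are distinct, are not adjacent because they share the first
   coordinate, and have a common neighbour. *)
have far (k : nat) : 0 < k < p ^ alpha -> 2 < p \/ 0 = k %[mod p] -> 1 < diam (Gamma p alpha).
  move=> /andP[k_gt0 k_lt] hk.
  pose y : 'Z_p * 'Z_(p ^ alpha) := (0, k%:R)%R.
  have y2E : y.2 = k :> nat by rewrite val_Zp_nat ?prime_exp_gt1 // modn_small.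
  have conn0y : connect (Gamma p alpha) (0, 0)%R y.
    have /existsP[w /andP[wp /eqP wy]] : has_walk (Gamma p alpha) (0, 0)%R y 2.
      by apply: Gamma_walk2 => //; rewrite y2E; case: hk => [|hk]; [left | right].
    by apply/connectP; exists w.
  apply: leq_trans (dist_leq_diam conn0y); rewrite dist_gt1 //.
    by apply: contraTneq k_gt0 => y0; rewrite -y2E -y0.
  by rewrite GammaE // eqxx.
(* For [p = 2] the offset [k] must be even, and [k = 2] lies below [2 ^ alpha] because [alpha >= 2];
   for [p >= 3], [k = 1] will do. *)
case: cases => [[p2 alpha_ge2]|[p_gt2 _]].
  apply: (far 2); last by right; rewrite p2.
  by rewrite /= p2 (@leq_trans (2 ^ 2)) // leq_exp2l.
by apply: (far 1); [rewrite prime_exp_gt1 | left].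
Qed.
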